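(* Let $n\ge 2$ be an integer and let $q>n$ be a real number. Then there exist origin-symmetric convex bodies $K$ and $L$ in $\mathbb{R}^n$ such that $$\widetilde V_q\Big(\tfrac12\cdot K+_0\tfrac12\cdot L\Big)\ <\ \widetilde V_q(K)^{\frac12}\,\widetilde V_q(L)^{\frac12}.$$
   Context: A convex body in $\mathbb{R}^n$ is a compact convex set with non-empty interior; it is origin-symmetric if $K=-K$. For a convex body $K$ with the origin in its interior, the radial function is $\rho_K(x)=\sup\{\lambda\ge 0:\lambda x\in K\}$ for $x\in\mathbb{R}^n\setminus\{0\}$, the support function is $h_K(x)=\max\{x\cdot y:y\in K\}$, and the $q$-th dual quermassintegral is $$\widetilde V_q(K)=\frac1n\int_{\mathbb{S}^{n-1}}\rho_K^q(u)\,du,\qquad q\in\mathbb{R},$$ where $du$ is spherical Lebesgue measure. For a continuous function $h:\mathbb{S}^{n-1}\to(0,\infty)$ the Wulff shape of $h$ is $[h]=\{x\in\mathbb{R}^n: x\cdot v\le h(v)\text{ for all }v\in\mathbb{S}^{n-1}\}$. The geometric (logarithmic) combination of origin-symmetric convex bodies $K,L$ is $(1-\lambda)\cdot K+_0\lambda\cdot L=[h_K^{1-\lambda}h_L^{\lambda}]$ for $0\le\lambda\le1$. *)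

(* Defs.v *)
From HB Require Import structures.
From mathcomp Require Import all_boot all_order all_algebra.
From mathcomp Require Import all_classical all_reals all_analysis.
From mathcomp Require Import measurable_realfun.

Set Implicit Arguments.
Unset Strict Implicit.
Unset Printing Implicit Defensive.
Import Order.TTheory GRing.Theory Num.Theory.
Import numFieldNormedType.Exports.

Local Open Scope classical_set_scope.
Local Open Scope ring_scope.

(* R^n is 'rV[R]_n with the topology of MathComp-Analysis.  The library norm
   `|x| on 'rV[R]_n is the max norm, hence the Euclidean structure below. *)

Definition dotv (R : realType) (n : nat) (x y : 'rV[R]_n) : R :=
  \sum_(i < n) x ord0 i * y ord0 i.

Definition enorm (R : realType) (n : nat) (x : 'rV[R]_n) : R :=
  Num.sqrt (dotv x x).

Definition unit_sphere (R : realType) (n : nat) : set 'rV[R]_n :=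
  [set x | enorm x = 1].

Definition unit_ball (R : realType) (n : nat) : set 'rV[R]_n :=
  [set x | enorm x <= 1].

Definition normalize (R : realType) (n : nat) (x : 'rV[R]_n) : 'rV[R]_n :=
  (enorm x)^-1 *: x.

Definition measure_rV_display : measure_display.
Proof. exact: default_measure_display. Qed.

(* The Borel sigma-algebra of R^n, as the product sigma-algebra: it is the
   one generated by the coordinate functions. *)
Section measurable_rV.
Variables (R : realType) (n : nat).

Let coord : 'I_n -> 'rV[R]_n -> R := fun i x => x ord0 i.

Let rV_set0 : g_sigma_preimage coord set0.
Proof. exact: sigma_algebra0. Qed.

Let rV_setC A : g_sigma_preimage coord A -> g_sigma_preimage coord (~` A).
Proof. exact: sigma_algebraC. Qed.

Let rV_bigcup (F : (set 'rV[R]_n)^nat) :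
  (forall i, g_sigma_preimage coord (F i)) ->
  g_sigma_preimage coord (\bigcup_i (F i)).
Proof. exact: sigma_algebra_bigcup. Qed.

HB.instance Definition _ := @isMeasurable.Build measure_rV_display
  'rV[R]_n (g_sigma_preimage coord) rV_set0 rV_setC rV_bigcup.

Lemma measurable_coord (i : 'I_n) :
  measurable_fun [set: 'rV[R]_n] (fun x : 'rV[R]_n => x ord0 i).
Proof.
move=> _ Y mY; rewrite setTI; apply: sub_sigma_algebra => /=.
rewrite -bigcup_seq/=; exists i => /=; first by rewrite mem_index_enum.
by exists Y => //; rewrite setTI.
Qed.

Lemma measurable_fun_rV d (T : measurableType d) (f : T -> 'rV[R]_n) :
  (forall i, measurable_fun [set: T] (fun t => f t ord0 i)) ->
  measurable_fun [set: T] f.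
Proof.
move=> mf _ Y mY; rewrite setTI.
suff : (measurable : set_system 'rV[R]_n) `<=` [set A | measurable (f @^-1` A)].
  exact.
apply: smallest_sub; first split => /=.
- by rewrite preimage_set0.
- move=> A mA; rewrite setTD preimage_setC; exact: measurableC.
- by move=> F mF; rewrite preimage_bigcup; exact: bigcup_measurable.
- move=> A; rewrite -bigcup_seq => -[i _ [B mB <-]] /=.
  rewrite setTI -[X in measurable X]setTI; exact: mf.
Qed.

End measurable_rV.

Lemma measurable_enorm (R : realType) (n : nat) :
  measurable_fun [set: 'rV[R]_n] (@enorm R n).
Proof.
apply: measurableT_comp.
  by apply: continuous_measurable_fun; exact: sqrt_continuous.
apply: measurable_sum => i.
by apply: measurable_funM; exact: measurable_coord.
Qed.

Lemma measurable_unit_ball (R : realType) (n : nat) :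
  measurable (@unit_ball R n).
Proof.
rewrite (_ : @unit_ball R n = @enorm R n @^-1` `]-oo, 1]); last first.
  by apply/seteqP; split=> x /=; rewrite in_itv.
by rewrite -[X in measurable X]setTI; exact: measurable_enorm.
Qed.

Lemma measurable_normalize (R : realType) (n : nat) :
  measurable_fun [set: 'rV[R]_n] (@normalize R n).
Proof.
apply: measurable_fun_rV => i.
apply: (eq_measurable_fun (fun x : 'rV[R]_n => (enorm x)^-1 * x ord0 i)).
  by move=> x _; rewrite /normalize mxE.
apply: measurable_funM; last exact: measurable_coord.
apply: (eq_measurable_fun (fun x : 'rV[R]_n => enorm x `^ (-1))).
  by move=> x _; rewrite powR_inv1 // sqrtr_ge0.
apply: (@measurableT_comp _ _ _ _ _ _ (@powR R ^~ (-1))).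
  exact: measurable_powR.
exact: measurable_enorm.
Qed.

(* Lebesgue measure on R^n, by recursion on n: transport the product of the
   Lebesgue measures of R and R^n along R x R^n ~ R^(n+1). *)

Definition consrV (R : realType) (n : nat) (p : R * 'rV[R]_n) :
    'rV[R]_n.+1 :=
  \row_i oapp (fun j => p.2 ord0 j) p.1 (unlift ord0 i).

Lemma measurable_consrV (R : realType) (n : nat) :
  measurable_fun [set: R * 'rV[R]_n] (@consrV R n).
Proof.
apply: measurable_fun_rV => i.
case: (unliftP ord0 i) => [j|] ->.
  apply: (eq_measurable_fun (fun p : R * 'rV[R]_n => p.2 ord0 j)).
    by move=> p _; rewrite mxE liftK.
  exact: measurableT_comp (measurable_coord j) measurable_snd.
apply: (eq_measurable_fun fst); last exact: measurable_fst.
by move=> p _; rewrite mxE unlift_none.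
Qed.

Section lebesgue_step.
Variables (R : realType) (n : nat).
Variable mu : {sigma_finite_measure set 'rV[R]_n -> \bar R}.

Definition lebesgue_step : set 'rV[R]_n.+1 -> \bar R :=
  pushforward (@lebesgue_measure R \x mu)%E (@consrV R n).

Let mcons := @measurable_consrV R n.

Let step0 : lebesgue_step set0 = 0%E.
Proof. exact: measure0. Qed.

Let step_ge0 A : (0 <= lebesgue_step A)%E.
Proof. exact: measure_ge0. Qed.

Let step_sigma_additive : semi_sigma_additive lebesgue_step.
Proof. exact: measure_semi_sigma_additive. Qed.

HB.instance Definition _ := isMeasure.Build _ _ _ lebesgue_step
  step0 step_ge0 step_sigma_additive.

Let uncons (x : 'rV[R]_n.+1) : measurableTypeR R * 'rV[R]_n :=
  (x ord0 ord0, \row_j x ord0 (lift ord0 j)).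

Let unconsK : cancel (@consrV R n) uncons.
Proof.
move=> [a v]; congr (_, _); first by rewrite mxE unlift_none.
by apply/rowP => j; rewrite !mxE liftK.
Qed.

Let measurable_uncons : measurable_fun [set: 'rV[R]_n.+1] uncons.
Proof.
apply: measurable_fun_pair; first exact: measurable_coord.
apply: measurable_fun_rV => j.
apply: (eq_measurable_fun (fun x : 'rV[R]_n.+1 => x ord0 (lift ord0 j))).
  by move=> x _; rewrite mxE.
exact: measurable_coord.
Qed.

Let step_sigma_finite : sigma_finite setT lebesgue_step.
Proof.
have /sigma_finiteP[F [TF ndF Foo]] := sigma_finiteT (@lebesgue_measure R).
have /sigma_finiteP[G [TG ndG Goo]] := sigma_finiteT mu.
exists (fun i => uncons @^-1` (F i `*` G i)).
  rewrite -preimage_bigcup; apply/esym; rewrite -subTset => x _.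
  have [k _ Fk] : (\bigcup_i F i) (uncons x).1 by rewrite -TF.
  have [l _ Gl] : (\bigcup_i G i) (uncons x).2 by rewrite -TG.
  exists (maxn k l) => //; split.
  - by move: Fk; exact/subsetPset/ndF/leq_maxl.
  - by move: Gl; exact/subsetPset/ndG/leq_maxr.
move=> i; have [mF Fi] := Foo i; have [mG Gi] := Goo i; split.
  rewrite -[X in measurable X]setTI.
  by apply: measurable_uncons => //; exact: measurableX.
rewrite /lebesgue_step /pushforward -comp_preimage.
rewrite (_ : uncons \o _ = id); last by apply/funext => p; exact: unconsK.
by rewrite preimage_id product_measure1E// lte_mul_pinfty// ge0_fin_numE.
Qed.

HB.instance Definition _ := Measure_isSigmaFinite.Build _ _ _ lebesgue_step
  step_sigma_finite.

End lebesgue_step.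

Fixpoint lebesgue_rV (R : realType) (n : nat) :
    {sigma_finite_measure set 'rV[R]_n -> \bar R} :=
  match n with
  | 0 => @dirac _ 'rV[R]_0 0 R
  | m.+1 => lebesgue_step (lebesgue_rV R m)
  end.

Lemma lebesgue_rV_box (R : realType) (n : nat) (A : 'I_n -> set R) :
  (forall i, measurable (A i)) ->
  measurable [set x : 'rV[R]_n | forall i, A i (x ord0 i)] /\
  lebesgue_rV R n [set x | forall i, A i (x ord0 i)] =
  (\prod_(i < n) @lebesgue_measure R (A i))%E.
Proof.
elim: n A => [|n IHn] A mA.
  rewrite (_ : [set _ | _] = setT); last by apply/seteqP; split => // x _ [].
  split; first exact: measurableT.
  by rewrite big_ord0 [LHS]diracE mem_set => // -[].
have [mB EB] := IHn _ (fun i => mA (lift ord0 i)).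
split.
  rewrite (_ : [set _ | _] = \bigcap_(i in [set: 'I_n.+1]) ((fun x : 'rV[R]_n.+1 => x ord0 i) @^-1` A i)).
    apply: fin_bigcap_measurable => // i _.
    by rewrite -[X in measurable X]setTI; exact: measurable_coord.
  apply/seteqP; split => x /= H i; first by move=> _; exact: H.
  by have := H i Logic.I.
rewrite big_ord_recl -EB -product_measure1E//.
pose B := [set x : 'rV[R]_n.+1 | forall i, A i (x ord0 i)]; set C := _ `*` _.
suff -> : C = @consrV R n @^-1` B by [].
apply/seteqP; split=> -[a v] /=; last first.
  move=> H; split; first by have := H ord0; rewrite mxE unlift_none.
  by move=> i; have := H (lift ord0 i); rewrite mxE liftK.
by move=> [Aa Av] i; rewrite mxE; case: unliftP => [j|] ->//=.
exact: mA.
Qed.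

(* Spherical Lebesgue measure of A, as n times the Lebesgue measure of the
   cone {x : 0 < |x| <= 1, x / |x| in A} over A.  It lives on the whole space,
   so integrals against it must be restricted to unit_sphere (normalize sends
   0 to 0, which is not in unit_sphere). *)
Section sphere_measure.
Variables (R : realType) (n : nat).

Definition cone_measure : set 'rV[R]_n -> \bar R :=
  pushforward (mrestr (lebesgue_rV R n) (@measurable_unit_ball R n))
    (@normalize R n).

Let mnormalize := @measurable_normalize R n.

Let cone0 : cone_measure set0 = 0%E.
Proof. exact: measure0. Qed.

Let cone_ge0 A : (0 <= cone_measure A)%E.
Proof. exact: measure_ge0. Qed.

Let cone_sigma_additive : semi_sigma_additive cone_measure.
Proof. exact: measure_semi_sigma_additive. Qed.

HB.instance Definition _ := isMeasure.Build _ _ _ cone_measure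
  cone0 cone_ge0 cone_sigma_additive.

Definition sphere_measure : {measure set 'rV[R]_n -> \bar R} :=
  mscale n%:R%:nng cone_measure.

Lemma sphere_measureE (A : set 'rV[R]_n) :
  sphere_measure A =
  (n%:R%:E * lebesgue_rV R n [set x | A (normalize x) /\ (enorm x <= 1)%R])%E.
Proof. by []. Qed.

End sphere_measure.

Definition convex_body (R : realType) (n : nat) (K : set 'rV[R]_n) : Prop :=
  [/\ compact K, convex_set (K : set (convex_lmodType 'rV[R]_n))
    & interior K !=set0].

Definition origin_symmetric (R : realType) (n : nat) (K : set 'rV[R]_n) :
    Prop :=
  K = [set - x | x in K].

Definition radial (R : realType) (n : nat) (K : set 'rV[R]_n)
    (x : 'rV[R]_n) : R :=
  sup [set l : R | 0 <= l /\ K (l *: x)].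

(* The maximum of x . y over y in K; it is attained when K is compact. *)
Definition support_fun (R : realType) (n : nat) (K : set 'rV[R]_n)
    (x : 'rV[R]_n) : R :=
  sup [set dotv x y | y in K].

Definition dual_quermassintegral (R : realType) (n : nat) (q : R)
    (K : set 'rV[R]_n) : R :=
  n%:R^-1 *
  \int[sphere_measure R n]_(u in @unit_sphere R n) (radial K u `^ q).

Definition wulff_shape (R : realType) (n : nat) (h : 'rV[R]_n -> R) :
    set 'rV[R]_n :=
  [set x | forall v, unit_sphere v -> dotv x v <= h v].

Definition log_combination (R : realType) (n : nat) (l : R)
    (K L : set 'rV[R]_n) : set 'rV[R]_n :=
  wulff_shape (fun v => support_fun K v `^ (1 - l) * support_fun L v `^ l).

(* Main.v *)
(* Boxes give the counterexample.  Take K = [-t, t] x [-1, 1]^(n-1) and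
   L = [-1/t, 1/t] x [-1, 1]^(n-1).  Testing the Wulff shape in the directions
   +-e_i shows that the logarithmic mean of K and L lies in the unit cube, so its
   dual quermassintegral is bounded independently of t.  On the other hand a box
   with semi-axes a_i and longest semi-axis M has radial function at least M/2 in
   the directions u with |u_i| <= 2 a_i / M, whose spherical measure is at least
   a constant times M^(-n) prod a_i.  Hence the q-th dual quermassintegral is at
   least c M^(q-n) prod a_i, and the product over K and L is at least
   c^2 t^(q-n), which tends to infinity with t because q > n. *)
Require Import Defs.
From mathcomp Require Import all_boot all_order all_algebra.
From mathcomp Require Import all_classical all_reals all_analysis.
From mathcomp Require Import ring lra.
Import Order.TTheory GRing.Theory Num.Theory.
Import numFieldNormedType.Exports.
Local Open Scope classical_set_scope.
Local Open Scope ring_scope.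
Set Implicit Arguments.
Unset Strict Implicit.

(* Monotonicity holds without measurability since the integral of a nonnegative
   function is a supremum over simple functions below it. *)
Lemma ge0_le_integral_nonmeasurable d (T : measurableType d) (R : realType)
    (mu : {measure set T -> \bar R}) (D : set T) (f g : T -> \bar R) :
  (forall x, D x -> 0 <= f x)%E -> (forall x, D x -> f x <= g x)%E ->
  (\int[mu]_(x in D) f x <= \int[mu]_(x in D) g x)%E.
Proof.
move=> f0 fg; rewrite !ge0_integralE //; last first.
  by move=> x Dx; exact: le_trans (f0 _ Dx) (fg _ Dx).
apply: ereal_sup_le => _ [h /= hf <-]; exists h => //= x.
exact: le_trans (hf x) (lee_restrict fg x).
Qed.

(** * The Euclidean norm against the coordinates *)

Section euclidean.
Context {R : realType} {n : nat}.
Implicit Types (x u : 'rV[R]_n) (c : R).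

Lemma dotvv_ge0 x : 0 <= dotv x x.
Proof. by apply: sumr_ge0 => i _; rewrite -expr2 sqr_ge0. Qed.

Lemma coord_le_enorm x i : `|x ord0 i| <= enorm x.
Proof.
rewrite -sqrtr_sqr ler_sqrt ?dotvv_ge0//= /dotv (bigD1 i)//= -expr2 lerDl.
by apply: sumr_ge0 => j _; rewrite -expr2 sqr_ge0.
Qed.

Lemma enorm_le c x : 0 <= c -> (forall i, `|x ord0 i| <= c) ->
  enorm x <= n%:R * c.
Proof.
move=> c0 xc; have nc0 : 0 <= n%:R * c by exact: mulr_ge0.
rewrite -[leRHS](ger0_norm nc0) -sqrtr_sqr ler_wsqrtr//.
apply: (@le_trans _ _ (\sum_(i < n) c ^+ 2)).
  apply: ler_sum => i _; rewrite -expr2 -real_normK ?num_real//.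
  by rewrite ler_sqr ?nnegrE.
rewrite sumr_const card_ord -[_ *+ n]mulr_natl exprMn.
apply: ler_wpM2r; first exact: sqr_ge0.
(* The sum of squares is at most [n * c ^+ 2]; the crude bound [n <= n ^ 2] avoids a square root of
   [n]. *)
by rewrite -natrX ler_nat; case: (n) => // m; exact: leq_pmulr.
Qed.

Lemma enormZ c x : 0 <= c -> enorm (c *: x) = c * enorm x.
Proof.
move=> c0; rewrite -{2}(ger0_norm c0) -sqrtr_sqr -sqrtrM ?sqr_ge0//.
by congr Num.sqrt; rewrite mulr_sumr; apply: eq_bigr => i _; rewrite !mxE; ring.
Qed.

Lemma normalizeE x i : normalize x ord0 i = x ord0 i / enorm x.
Proof. by rewrite mxE mulrC. Qed.

Lemma enorm_normalize x : 0 < enorm x -> enorm (normalize x) = 1.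
Proof.
move=> x0; rewrite /enorm /dotv.
under eq_bigr do rewrite !normalizeE mulrACA.
rewrite -mulr_suml -/(dotv x x) -invfM -expr2 sqr_sqrtr ?dotvv_ge0//.
rewrite divff ?sqrtr1// gt_eqF//.
by move: x0; rewrite sqrtr_gt0.
Qed.

End euclidean.

(** * Boxes as origin-symmetric convex bodies *)

Definition box {R : realType} {n : nat} (a : 'I_n -> R) : set 'rV[R]_n :=
  [set x | forall i, `|x ord0 i| <= a i].

Section box.
Context {R : realType} {n : nat}.
Variable a : 'I_n -> R.
Hypothesis a_gt0 : forall i, 0 < a i.

Lemma compact_box : compact (box a).
Proof.
rewrite (_ : box a = [set x | forall i, `[- a i, a i]%classic (x ord0 i)]).
  exact: (rV_compact (fun i => @segment_compact R (- a i) (a i))).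
by apply/seteqP; split=> x /= xa i; have := xa i; rewrite in_itv/= ler_norml.
Qed.

Lemma convex_box : convex_set (box a : set (convex_lmodType 'rV[R]_n)).
Proof.
move=> x y l; rewrite !inE => xa ya i; rewrite !mxE.
apply: le_trans (ler_normD _ _) _; rewrite !normrM.
have l0 : 0 <= l%:num by [].
have l1 : 0 <= 1 - l%:num by rewrite subr_ge0.
rewrite (ger0_norm l0) (ger0_norm l1).
have -> : a i = l%:num * a i + (1 - l%:num) * a i by ring.
by rewrite lerD// ler_wpM2l.
Qed.

Lemma interior_box0 : interior (box a) 0.
Proof.
have e0 : 0 < \big[Num.min/1]_i a i by exact: lt_bigmin.
(* Balls of the max norm are cubes, so the least semi-axis can serve as radius; the default 1 keeps
   the minimum positive when [n = 0]. *)
apply/nbhs_ballP; exists (\big[Num.min/1]_i a i) => //= x [_ x0] i.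
have := x0 ord0 i; rewrite /ball/= mxE sub0r normrN => /ltW xe.
by rewrite (le_trans xe)// bigmin_le.
Qed.

Lemma convex_body_box : convex_body (box a).
Proof.
by split; [exact: compact_box|exact: convex_box|exists 0; exact: interior_box0].
Qed.

Lemma origin_symmetric_box : origin_symmetric (box a).
Proof.
apply/seteqP; split=> [x xa|_ [x xa <-] i]; last by rewrite mxE normrN.
by exists (- x); rewrite ?opprK// => i; rewrite mxE normrN.
Qed.

Lemma support_fun_box v : support_fun (box a) v = \sum_i a i * `|v ord0 i|.
Proof.
have ub : ubound [set dotv v y | y in box a] (\sum_i a i * `|v ord0 i|).
  move=> _ [y ya <-]; apply: ler_sum => i _.
  by rewrite (le_trans (ler_norm _))// normrM mulrC ler_wpM2r.
apply/eqP; rewrite eq_le; apply/andP; split.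
  apply: ge_sup ub; exists (dotv v 0); exists 0 => //= i.
  by rewrite mxE normr0 ltW.
rewrite /support_fun; apply: ub_le_sup; first by eexists; exact: ub.
(* The maximum is attained where each coordinate has size [a i] and the sign of [v i], or vanishes
   with [v i]. *)
exists (\row_i (a i * Num.sg (v ord0 i))).
  move=> i; rewrite mxE normrM gtr0_norm// ler_piMr ?(ltW (a_gt0 i))//.
  by rewrite normr_sg lern1 leq_b1.
by apply: eq_bigr => i _; rewrite mxE normrEsg; ring.
Qed.

End box.

(** * Radial functions of bounded sets containing the origin *)

Section radial.
Context {R : realType} {n : nat}.
Variables (K : set 'rV[R]_n) (b : R).
Hypotheses (K0 : K 0) (Kb : K `<=` box (fun=> b)).
Implicit Types (u : 'rV[R]_n) (l : R).

(** A [sup] can be used only once its set is known to be bounded. Here [l] is the norm of [l *: u],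
    a point of the cube of semi-axis [b]. *)
Let ub_radial u : enorm u = 1 ->
  ubound [set l : R | 0 <= l /\ K (l *: u)] (n%:R * b).
Proof.
move=> u1 l /= [l0 Kl]; rewrite -[leLHS]mulr1 -[X in _ * X]u1 -enormZ//.
case: (posnP n) => [n0|n_gt0]; last first.
  apply: enorm_le; last exact: Kb.
  exact: le_trans (normr_ge0 _) (Kb Kl (Ordinal n_gt0)).
rewrite /enorm /dotv big1 ?sqrtr0 ?n0 ?mul0r// => -[i lt_in] _.
by exfalso; move: lt_in; rewrite n0.
Qed.

Lemma radial_le u : enorm u = 1 -> radial K u <= n%:R * b.
Proof.
move=> u1; apply: ge_sup (ub_radial u1).
by exists 0; split => //; rewrite scale0r.
Qed.

Lemma radial_ge u l : enorm u = 1 -> 0 <= l -> K (l *: u) -> l <= radial K u.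
Proof.
move=> u1 l0 Kl; rewrite /radial; apply: ub_le_sup; last by split.
by exists (n%:R * b); exact: ub_radial.
Qed.

Lemma radial_ge0 u : enorm u = 1 -> 0 <= radial K u.
Proof. by move=> u1; apply: radial_ge; rewrite ?scale0r. Qed.

End radial.

(** * Volumes of boxes and spherical measure *)

Section sphere_measure.
Context {R : realType} {n : nat}.

Lemma measurable_unit_sphere : measurable (@unit_sphere R n).
Proof.
rewrite -[X in measurable X]setTI.
exact: (measurable_enorm measurableT (measurable_set1 1)).
Qed.

Lemma measurable_cone (A : set 'rV[R]_n) : measurable A ->
  measurable [set x | A (normalize x) /\ enorm x <= 1].
Proof.
move=> mA; apply: measurableI; last exact: measurable_unit_ball.
by rewrite -[X in measurable X]setTI; exact: measurable_normalize.
Qed.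

Lemma lebesgue_rV_itv (a b : 'I_n -> R) : (forall i, a i <= b i) ->
  lebesgue_rV R n [set x | forall i, `[a i, b i]%classic (x ord0 i)] =
  (\prod_i (b i - a i))%:E.
Proof.
move=> ab; rewrite (lebesgue_rV_box (fun i => measurable_itv `[a i, b i])).2.
rewrite -prodEFin; apply: eq_bigr => i _.
rewrite lebesgue_measure_itv/= lte_fin -EFinB.
(* The length formula is conditional on [a i < b i]; a degenerate interval is treated apart. *)
have := ab i; rewrite le_eqVlt => /predU1P[->|->//].
by rewrite ltxx subrr.
Qed.

(** The cone over the sphere lies in the cube [[-1, 1]^n], of volume [2 ^+ n]. *)
Lemma sphere_measure_unit_sphere :
  (sphere_measure R n (@unit_sphere R n) <= (n%:R * 2 ^+ n)%:E)%E.
Proof.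
rewrite sphere_measureE EFinM lee_wpmul2l ?lee_fin//.
have -> : 2 ^+ n = \prod_(i < n) (1 - (- 1)) :> R.
  by rewrite prodr_const card_ord opprK.
rewrite -lebesgue_rV_itv => [|i]; last by lra.
apply: le_measure; rewrite ?inE.
- exact: measurable_cone measurable_unit_sphere.
- exact: (lebesgue_rV_box (fun i => measurable_itv `[-1, 1])).1.
move=> x /= [_ x1] i; rewrite in_itv/= -ler_norml.
exact: le_trans (coord_le_enorm _ _) x1.
Qed.

End sphere_measure.

(** * Bounds for dual quermassintegrals *)

Section dual_quermassintegral_bounds.
Context {R : realType} {n : nat}.
Variables (K : set 'rV[R]_n) (b q : R).
Hypotheses (K0 : K 0) (Kb : K `<=` box (fun=> b)) (q0 : 0 <= q).

Lemma integral_radial_le :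
  (\int[sphere_measure R n]_(u in @unit_sphere R n) (radial K u `^ q)%:E
   <= ((n%:R * b) `^ q * (n%:R * 2 ^+ n))%:E)%E.
Proof.
apply: (@le_trans _ _ (\int[sphere_measure R n]_(u in @unit_sphere R n)
    cst ((n%:R * b) `^ q)%:E u)%E).
  apply: ge0_le_integral_nonmeasurable => u /= u1; rewrite lee_fin ?powR_ge0//.
  have r0 := radial_ge0 K0 Kb u1; have rb := radial_le K0 Kb u1.
  by apply: ge0_ler_powR; rewrite ?nnegrE// (le_trans r0).
rewrite integral_cst ?EFinM; last exact: measurable_unit_sphere.
rewrite lee_wpmul2l ?lee_fin ?powR_ge0// -EFinM.
exact: sphere_measure_unit_sphere.
Qed.

(** The real-valued integral is the [fine] part of this one, so finiteness is what lets
    extended-real estimates pass to [dual_quermassintegral]. *)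
Lemma integral_radial_fin_num :
  (\int[sphere_measure R n]_(u in @unit_sphere R n) (radial K u `^ q)%:E)%E
    \is a fin_num.
Proof.
rewrite ge0_fin_numE.
  exact: le_lt_trans integral_radial_le (ltry _).
by apply: integral_ge0 => u _; rewrite lee_fin powR_ge0.
Qed.

Lemma dual_quermassintegral_le : (0 < n)%N ->
  dual_quermassintegral q K <= (n%:R * b) `^ q * 2 ^+ n.
Proof.
move=> n_gt0; rewrite /dual_quermassintegral ler_pdivrMl ?ltr0n//.
rewrite -lee_fin fineK ?integral_radial_fin_num//.
by rewrite mulrCA; exact: integral_radial_le.
Qed.

(** Only the directions in [A] are kept, where the radial function is at least [r]. The factor [n]
    in [sphere_measure] cancels [n^-1], leaving the volume of the cone over [A]. *)
Lemma dual_quermassintegral_ge (r : R) (A : set 'rV[R]_n) :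
  (0 < n)%N -> 0 <= r -> measurable A -> A `<=` @unit_sphere R n ->
  (forall u, A u -> K (r *: u)) ->
  ((r `^ q)%:E * lebesgue_rV R n [set x | A (normalize x) /\ (enorm x <= 1)%R]
   <= (dual_quermassintegral q K)%:E)%E.
Proof.
move=> n_gt0 r0 mA AS AK.
rewrite /dual_quermassintegral EFinM fineK ?integral_radial_fin_num//.
rewrite lee_pdivlMl ?ltr0n// muleCA -sphere_measureE -integral_cst//.
(* The constant on [A] is extended by 0 to the sphere, so that the integrands compare pointwise. *)
rewrite -(setIidr AS) integral_mkcondr.
apply: ge0_le_integral_nonmeasurable => u u1; rewrite patchE; case: ifPn => //.
- by rewrite lee_fin powR_ge0.
- rewrite inE => Au; rewrite lee_fin.
  have ru := radial_ge Kb u1 r0 (AK _ Au).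
  by apply: ge0_ler_powR; rewrite ?nnegrE// (le_trans r0).
- by rewrite lee_fin powR_ge0.
Qed.

End dual_quermassintegral_bounds.

(** * The lower bound for a box *)

Section dual_quermassintegral_box.
Context {R : realType} {n : nat}.
Variables (a : 'I_n -> R) (j : 'I_n) (q : R).
Hypotheses (a_gt0 : forall i, 0 < a i) (a_le : forall i, a i <= a j).
Hypothesis q0 : 0 <= q.

(* Directions in which the radial function of the box is at least [a j / 2]. *)
Let A : set 'rV[R]_n :=
  @unit_sphere R n `&` [set u | forall i,
    `[- (2 * a i / a j), 2 * a i / a j]%classic (u ord0 i)].

Let n_gt0 : (0 < n)%N. Proof. exact: leq_ltn_trans (ltn_ord j). Qed.

Let measurable_A : measurable A.
Proof.
apply: measurableI; first exact: measurable_unit_sphere.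
exact: (lebesgue_rV_box (fun i =>
  measurable_itv `[- (2 * a i / a j), 2 * a i / a j])).1.
Qed.

(** The cone over [A] contains an explicit box, whose volume is easy. Its upper ends force norm at
    most 1; its [j]-th lower end [1 / (2 n)] bounds the norm below, and dividing by the norm gives
    the bounds defining [A]. *)
Let sub_cone : [set x : 'rV[R]_n | forall i,
    `[a i / (2 * n%:R * a j), a i / (n%:R * a j)]%classic (x ord0 i)] `<=`
  [set x | A (normalize x) /\ enorm x <= 1].
Proof.
have n0 : 0 < n%:R :> R by rewrite ltr0n.
have aj0 : 0 < a j by [].
move=> x /= xI.
have x_ge0 i : 0 < x ord0 i.
  have := xI i; rewrite in_itv/= => /andP[+ _]; apply: lt_le_trans.
  by rewrite divr_gt0// !mulr_gt0.
have x_le i : `|x ord0 i| <= a i / (n%:R * a j).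
  by have := xI i; rewrite gtr0_norm// in_itv/= => /andP[].
have x_big : (2 * n%:R)^-1 <= enorm x.
  apply: le_trans (coord_le_enorm x j); rewrite gtr0_norm//.
  have := xI j; rewrite in_itv/= => /andP[+ _]; apply: le_trans.
  by rewrite le_eqVlt; apply/orP; left; apply/eqP; field; rewrite !gt_eqF.
have x0 : 0 < enorm x by apply: lt_le_trans x_big; rewrite invr_gt0 mulr_gt0.
split; last first.
  have -> : 1 = n%:R * n%:R^-1 :> R by rewrite divff// gt_eqF.
  apply: enorm_le => [|i]; first by rewrite invr_ge0 ltW.
  apply: le_trans (x_le i) _; rewrite invfM mulrCA ler_piMr ?invr_ge0 ?(ltW n0)//.
  by rewrite ler_pdivrMr// mul1r.
split; first exact: enorm_normalize.
move=> i /=; rewrite in_itv/= -ler_norml normalizeE normrM normfV (gtr0_norm x0).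
rewrite ler_pdivrMr//; apply: le_trans (x_le i) _.
have -> : a i / (n%:R * a j) = 2 * a i / a j * (2 * n%:R)^-1.
  by field; rewrite !gt_eqF.
by rewrite ler_wpM2l// divr_ge0 ?mulr_ge0 ?ltW.
Qed.

(** The radius [a j / 2] gives the powers with exponent [q]; the box inside the cone has sides
    [a i / (2 n a j)], whose product gives the rest. *)
Lemma dual_quermassintegral_box_ge :
  2^-1 `^ q * (2 * n%:R) ^- n * (a j `^ (q - n%:R) * \prod_i a i)
    <= dual_quermassintegral q (box a).
Proof.
have n0 : 0 < n%:R :> R by rewrite ltr0n.
have aj0 : 0 < a j by [].
have box0 : box a 0 by move=> i; rewrite mxE normr0 ltW.
have box_aj : box a `<=` box (fun=> a j).
  by move=> x xa i; exact: le_trans (xa i) (a_le i).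
have half0 : 0 <= a j / 2 by rewrite divr_ge0 ?ltW.
rewrite -lee_fin.
apply: le_trans (dual_quermassintegral_ge box0 box_aj q0 n_gt0 half0 measurable_A _ _).
- rewrite [X in (X%:E <= _)%E](_ : _ = (a j / 2) `^ q *
    \prod_i (a i / (n%:R * a j) - a i / (2 * n%:R * a j))).
    rewrite EFinM lee_wpmul2l ?lee_fin ?powR_ge0//.
    rewrite -lebesgue_rV_itv => [|i].
      apply: le_measure sub_cone; rewrite inE; last exact: measurable_cone.
      exact: (lebesgue_rV_box (fun i => measurable_itv `[_, _])).1.
    rewrite ler_pM2l// lef_pV2 ?posrE ?mulr_gt0// ler_pM2r// ler_peMl ?ltW//.
    by rewrite ltr1n.
  rewrite [X in _ = _ * X](eq_bigr (fun i => (2 * n%:R * a j)^-1 * a i)); last first.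
    by move=> i _; field; rewrite !gt_eqF.
  rewrite big_split/= prodr_const card_ord powRM ?invr_ge0 ?ltW//.
  have -> : a j `^ (q - n%:R) = a j `^ q / a j ^+ n.
    by rewrite -powR_mulrn ?(ltW aj0)// powRB// (gt_eqF aj0) implybT.
  by rewrite exprVn [(2 * n%:R * a j) ^+ n]exprMn invfM; ring.
- by move=> u [].
- move=> u [_ uA] i; rewrite mxE normrM (ger0_norm half0).
  have := uA i; rewrite /= in_itv/= -ler_norml ler_pdivlMr// => ui.
  by nra.
Qed.

End dual_quermassintegral_box.

(** * Logarithmic combinations of boxes *)

Lemma log_combination_box_sub {R : realType} {n : nat} (l : R)
    (a b c : 'I_n -> R) :
  (forall i, 0 < a i) -> (forall i, 0 < b i) ->
  (forall i, a i `^ (1 - l) * b i `^ l = c i) ->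
  log_combination l (box a) (box b) `<=` box c.
Proof.
move=> a0 b0 abc x xW i.
(* With [e] a sign, the support function of a box in the direction [e] times the [i]-th basis vector
   is the [i]-th semi-axis. *)
have h (e : R) (w : 'I_n -> R) : (forall i, 0 < w i) -> `|e| = 1 ->
    support_fun (box w) (e *: delta_mx ord0 i) = w i.
  move=> w0 e1; rewrite support_fun_box// (bigD1 i)//= !mxE !eqxx mulr1 e1 mulr1.
  rewrite big1 ?addr0// => k /negbTE ki.
  by rewrite !mxE ki andbF mulr0 normr0 mulr0.
have dot (e : R) y : dotv y (e *: delta_mx ord0 i) = e * y ord0 i.
  rewrite /dotv (bigD1 i)//= !mxE !eqxx mulr1 mulrC big1 ?addr0// => k /negbTE ki.
  by rewrite !mxE ki andbF !mulr0.
have W (e : R) : `|e| = 1 -> e * x ord0 i <= c i.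
  move=> e1; rewrite -dot -abc -(h e a)// -(h e b)//; apply: xW.
  rewrite /unit_sphere/= /enorm dot !mxE !eqxx mulr1 -expr2.
  by rewrite sqrtr_sqr.
by rewrite ler_norml lerNl -mulN1r W ?normrN1//= -[leLHS]mul1r W// normr1.
Qed.

(** * The counterexample *)

Theorem theorem1p4 (R : realType) (n : nat) (q : R)
    (hn : (2 <= n)%N) (hq : n%:R < q) :
  exists K L : set 'rV[R]_n,
    [/\ convex_body K, origin_symmetric K,
        convex_body L, origin_symmetric L
      & dual_quermassintegral q (log_combination (1 / 2) K L)
        < dual_quermassintegral q K `^ (1 / 2)
          * dual_quermassintegral q L `^ (1 / 2)].
Proof.
have n_gt0 : (0 < n)%N by exact: ltnW.
have q0 : 0 <= q by rewrite (le_trans _ (ltW hq)).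
(* Axis [i0] is stretched or shrunk; [i1], available since [n >= 2], keeps semi-axis 1 and is a
   longest axis of the shrunk box. *)
pose i0 : 'I_n := Ordinal n_gt0; pose i1 : 'I_n := Ordinal hn.
pose c : R := 2^-1 `^ q * (2 * n%:R) ^- n.
pose B : R := (n%:R * 1) `^ q * 2 ^+ n.
have c0 : 0 < c.
  by rewrite mulr_gt0 ?powR_gt0 ?invr_gt0 ?exprn_gt0 ?mulr_gt0 ?ltr0n.
have B0 : 0 <= B by rewrite mulr_ge0 ?powR_ge0 ?exprn_ge0.
have Bc0 : 0 <= B / c by rewrite divr_ge0// ltW.
(* Chosen so that [c ^+ 2 * t ^ (q - n)], the product of the two lower bounds, equals
   [(c + B) ^+ 2]. *)
pose t : R := (1 + B / c) `^ (2 / (q - n%:R)).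
have qn0 : 0 < q - n%:R by rewrite subr_gt0.
have tE : t `^ (q - n%:R) = (1 + B / c) ^+ 2.
  by rewrite -powRrM divfK ?gt_eqF// powR_mulrn// addr_ge0.
have t1 : 1 <= t.
  have e0 : 0 <= 2 / (q - n%:R) by rewrite divr_ge0 ?ltW.
  rewrite -[leLHS](congr1 (@^~ (2 / (q - n%:R))) (powR1 R)).
  by apply: ge0_ler_powR; rewrite ?nnegrE ?addr_ge0 ?lerDl.
have t0 : 0 < t by exact: lt_le_trans t1.
pose a (s : R) (i : 'I_n) : R := if i == i0 then s else 1.
have a0 s : 0 < s -> forall i, 0 < a s i by move=> s0 i; rewrite /a; case: ifP.
have prod_a s : \prod_i a s i = s.
  rewrite (bigD1 i0)//= /a eqxx big1 ?mulr1// => i /negbTE -> //.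
have at0 := a0 _ t0.
have atV0 : forall i, 0 < a t^-1 i by apply: a0; rewrite invr_gt0.
exists (box (a t)), (box (a t^-1)); split;
  try exact: convex_body_box; try exact: origin_symmetric_box.
have VK : c * (t `^ (q - n%:R) * t) <= dual_quermassintegral q (box (a t)).
  have := @dual_quermassintegral_box_ge R n (a t) i0 q at0.
  have -> : a t i0 = t by rewrite /a eqxx.
  by rewrite prod_a; apply => // i; rewrite /a; case: ifP.
have VL : c * t^-1 <= dual_quermassintegral q (box (a t^-1)).
  have := @dual_quermassintegral_box_ge R n (a t^-1) i1 q atV0.
  have -> : a t^-1 i1 = 1 by [].
  rewrite prod_a powR1 mul1r; apply => // i.
  by rewrite /a; case: ifP => // _; rewrite invf_le1.
have VC : dual_quermassintegral q
    (log_combination (1 / 2) (box (a t)) (box (a t^-1))) <= B.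
  apply: dual_quermassintegral_le => //.
    move=> v _; rewrite /dotv big1 ?mulr_ge0 ?powR_ge0// => i _.
    by rewrite mxE mul0r.
  (* The geometric mean of [t] and [t^-1] is 1, so the combination lies in the unit cube. *)
  apply: log_combination_box_sub => // i.
  rewrite (_ : 1 - 1 / 2 = 1 / 2); last by field.
  rewrite -powRM ?ltW// /a; case: ifP => _; last by rewrite mulr1 powR1.
  by rewrite divff ?gt_eqF// powR1.
apply: le_lt_trans VC _.
have lbK : 0 <= c * (t `^ (q - n%:R) * t).
  by rewrite mulr_ge0 ?(ltW c0)// mulr_ge0 ?powR_ge0 ?(ltW t0).
have lbL : 0 <= c * t^-1 by rewrite mulr_ge0 ?invr_ge0 ?(ltW c0) ?(ltW t0).
have VK0 := le_trans lbK VK; have VL0 := le_trans lbL VL.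
rewrite -powRM// div1r powR12_sqrt; last exact: mulr_ge0 VK0 VL0.
(* Strictness comes from [c > 0]; [c + B] is the square root of the product of the lower bounds. *)
apply: (@lt_le_trans _ _ (c + B)); first by rewrite ltrDr.
have cB0 : 0 <= c + B by rewrite addr_ge0// ltW.
rewrite -[leLHS](ger0_norm cB0) -sqrtr_sqr ler_wsqrtr//.
have -> : (c + B) ^+ 2 = c * (t `^ (q - n%:R) * t) * (c * t^-1).
  by rewrite tE; field; rewrite !gt_eqF.
exact: ler_pM lbK lbL VK VL.
Qed.
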